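(* Let $N\ge1$, consider the differential calculus of the fuzzy sphere spectral triple described in the context with $\mathcal{E}=\Omega^1(A_N)$ free with basis $e_k=1\otimes\sigma_k$ ($k=1,2,3$), and let $g$ be the canonical pseudo-Riemannian bilinear metric, i.e. the right $A_N$-linear extension of $g(e_k\otimes_{A_N}e_j)=\delta_{kj}$. Let $\nabla$ be the unique connection on $\mathcal{E}$ which is torsionless and compatible with $g$ on $\mathcal{Z}(\mathcal{E})$, and write $\nabla(e_k)=\sum_je_j\otimes_{A_N}\omega_{jk}$ with $\omega_{jk}\in\mathcal{E}$. Then $$\omega_{jk}=-\tfrac12\sum_{l}\epsilon_{jkl}\,e_l.$$
   Context: Fuzzy sphere spectral triple: $J_1,J_2,J_3$ basis of $su(2)$ with $[J_k,J_l]=\sum_m\epsilon_{klm}J_m$ ($\epsilon_{123}=1$); $\rho_{n/2}$ the $(n+1)$-dimensional irreducible unitary representation; $K_N=\oplus_{n=0}^N\mathbb{C}^{n+1}$, $X_k=\oplus_{n=0}^N\rho_{n/2}(J_k)$, $A_N=B(K_N)$, $H_N=K_N\otimes\mathbb{C}^2$ with $a\mapsto a\otimes1$, $\sigma_k=\sqrt{-1}\tau_k$ ($\tau_k$ Pauli matrices), $D_N=\sum_kX_k\otimes\sigma_k$. Differential calculus: $\Omega^1(A_N)=\{\sum a_j[D_N,b_j]\}$, $da=[D_N,a]$; $\Omega^2(A_N)=\mathcal{S}/J^2$ with $\mathcal{S}$ the span of $a_0[D_N,a_1][D_N,a_2]$ and $J^2=\{\sum_j[D_N,a_j][D_N,b_j]:\sum_ja_j[D_N,b_j]=0\}$;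 $\wedge$ is multiplication followed by the quotient; $d(\sum a_j[D_N,b_j])=[\sum_j[D_N,a_j][D_N,b_j]]$. The splitting used is $\mathcal{E}\otimes\mathcal{E}=\ker\wedge\oplus\mathcal{F}$ with $\mathcal{F}$ the antisymmetric tensors $\{\sum a_{kj}e_k\otimes e_j: a_{kj}=-a_{jk}\}$, and $\sigma=2P_{\rm sym}-1$ with $P_{\rm sym}$ the idempotent with image $\ker\wedge$ and kernel $\mathcal{F}$ (so $\sigma$ flips $e_k\otimes e_j$). A connection is a $\mathbb{C}$-linear $\nabla:\mathcal{E}\to\mathcal{E}\otimes_{A_N}\mathcal{E}$ with $\nabla(\omega a)=\nabla(\omega)a+\omega\otimes da$; torsionless means $\wedge\circ\nabla+d=0$; compatible with $g$ on $\mathcal{Z}(\mathcal{E})$ means $(g\otimes\mathrm{id})\{\sigma_{23}(\nabla(\omega)\otimes\eta)+\omega\otimes\nabla(\eta)\}=d(g(\omega\otimes\eta))$ for all central $\omega,\eta$, with $\sigma_{23}=\mathrm{id}\otimes\sigma$ and $(g\otimes\mathrm{id})(x\otimes y\otimes z)=g(x\otimes y)z$. *)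

(* Defs.v *)
From HB Require Import structures.
From mathcomp Require Import all_boot all_order all_algebra.
Set Implicit Arguments. Unset Strict Implicit. Unset Printing Implicit Defensive.
Import Order.TTheory GRing.Theory Num.Theory.
Local Open Scope ring_scope.

Section FuzzySphere.
Variable C : numClosedFieldType.

(* Levi-Civita symbol on indices 0,1,2 (standing for 1,2,3), eps 0 1 2 = 1 *)
Definition eps (i j k : 'I_3) : C :=
  if (i == j) || (j == k) || (i == k) then 0
  else if (j : nat) == ((i : nat).+1 %% 3)%N then 1 else -1.

Definition adjmx m (A : 'M[C]_m) : 'M[C]_m := map_mx Num.conj A^T.

(* rho : a representation of su(2) on C^m given by the images of J_1,J_2,J_3:
   skew-Hermitian (unitary), satisfying [J_k,J_l] = sum_m eps_klm J_m,
   and irreducible (no invariant subspace other than 0 and C^m;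
   a subspace is the column space of U^T, i.e. the row space of U). *)
Definition su2_unitary_irrep m (rho : 'I_3 -> 'M[C]_m) : Prop :=
  [/\ forall k, adjmx (rho k) = - rho k,
      forall k l, rho k *m rho l - rho l *m rho k = \sum_(q < 3) eps k l q *: rho q
    & forall U : 'M[C]_m, (forall k, stablemx U (rho k)^T) ->
        (U == 0) || row_full U].

Variable N : nat.
Definition blk (n : 'I_N.+1) : nat := n.+1.
Definition dK : nat := (\sum_(n < N.+1) blk n)%N.
Definition Alg := 'M[C]_dK.
Definition Op := 'M[C]_(dK + dK).                (* B(H_N), H_N = K_N (x) C^2 *)

(* a (x) s on K_N (x) C^2, with H_N = K_N (+) K_N (second tensor factor outer) *)
Definition tens (a : Alg) (s : 'M[C]_2) : Op :=
  block_mx (s 0 0 *: a) (s 0 1 *: a) (s 1 0 *: a) (s 1 1 *: a).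

Definition tau (k : 'I_3) : 'M[C]_2 :=
  \matrix_(i < 2, j < 2)
    match (k : nat), (i : nat), (j : nat) with
    | 0%N, 0%N, 1%N => 1 | 0%N, 1%N, 0%N => 1
    | 1%N, 0%N, 1%N => - 'i | 1%N, 1%N, 0%N => 'i
    | 2%N, 0%N, 0%N => 1 | 2%N, 1%N, 1%N => -1
    | _, _, _ => 0 end.
Definition sigma (k : 'I_3) : 'M[C]_2 := 'i *: tau k.

Variable rho : forall n : 'I_N.+1, 'I_3 -> 'M[C]_(blk n).

Definition X (k : 'I_3) : Alg := mxdiag (fun n => rho n k).
Definition piA (a : Alg) : Op := tens a 1%:M.
Definition DN : Op := \sum_(k < 3) tens (X k) (sigma k).
Definition e (k : 'I_3) : Op := tens 1%:M (sigma k).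
Definition comm (x y : Op) : Op := x *m y - y *m x.
Definition dA (a : Alg) : Op := comm DN (piA a).

Definition oneform (s : seq (Alg * Alg)) : Op :=
  \sum_(p <- s) piA p.1 *m dA p.2.
Definition Omega1 (w : Op) : Prop := exists s, w = oneform s.
(* representative of d(sum a_j [D,b_j]) in S: sum [D,a_j][D,b_j] *)
Definition dform (s : seq (Alg * Alg)) : Op :=
  \sum_(p <- s) dA p.1 *m dA p.2.
Definition J2 (x : Op) : Prop :=
  exists s, oneform s = 0 /\ x = dform s.

(* coordinates of w = sum_k e_k a_k in the basis e_k: a_k = -1/2 tr_2(w e_k) *)
Definition ptr (w : Op) : Alg := ulsubmx w + drsubmx w.
Definition coord (w : Op) (k : 'I_3) : Alg := - 2%:R^-1 *: ptr (w *m e k).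

(* E (x)_A E is free on e_k (x) e_j: T represents sum_{k,j} e_k (x) e_j T k j *)
Definition T2 := 'I_3 -> 'I_3 -> Alg.

Definition is_connection (nabla : Op -> T2) : Prop :=
  (forall (c : C) w v, Omega1 w -> Omega1 v ->
     forall k j, nabla (c *: w + v) k j = c *: nabla w k j + nabla v k j) /\
  (forall w (a : Alg), Omega1 w ->
     forall k j, nabla (w *m piA a) k j =
                 nabla w k j *m a + coord w k *m coord (dA a) j).

Definition wedge_rep (t : T2) : Op :=
  \sum_(k < 3) \sum_(j < 3) e k *m e j *m piA (t k j).

(* torsionless: wedge o nabla + d = 0 in Omega^2 = S / J^2 *)
Definition torsionless (nabla : Op -> T2) : Prop :=
  forall s, J2 (wedge_rep (nabla (oneform s)) + dform s).

Definition gmet (t : T2) : Alg := \sum_(k < 3) t k k.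

Definition central (w : Op) : Prop :=
  Omega1 w /\ forall a : Alg, piA a *m w = w *m piA a.

(* (g (x) id){ sigma_23(nabla w (x) v) + w (x) nabla v } = d(g(w (x) v)),
   with sigma the flip e_k (x) e_j |-> e_j (x) e_k.  Coordinates:
   (nabla w (x) v)_{k,j,l} = (nabla w)_{kj} v_l, sigma_23 swaps j,l,
   (w (x) nabla v)_{k,j,l} = w_k (nabla v)_{jl}, (g (x) id) contracts k=j. *)
Definition compatible (nabla : Op -> T2) : Prop :=
  forall w v, central w -> central v ->
    \sum_(l < 3) e l *m piA (\sum_(k < 3)
        (nabla w k l *m coord v k + coord w k *m nabla v k l))
    = dA (\sum_(k < 3) coord w k *m coord v k).

Definition omega (nabla : Op -> T2) (j k : 'I_3) : Op :=
  \sum_(l < 3) e l *m piA (nabla (e k) j l).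

End FuzzySphere.

(* Main.v *)
(* For matrices Y, c, summing matrix units gives families (a_j, b_j), called
   trace families, with sum_j a_j x b_j y = tr (Y x) c y. Since tr (X_k X_l)
   = kappa delta_kl with kappa <> 0 (skew-adjointness and nontriviality of
   the top block), Y = X_k / kappa shows that e_k is a one-form, and Y = 1 -
   dim K_N * P, with P the projection on the trivial block, shows J^2 = A
   (x) 1. As e_k e_j = - delta_kj - sum_l eps_kjl e_l, a class in Omega^2 is
   then the antisymmetric part of its coefficients. With nabla (e_k) =
   sum_pq e_p (x) e_q G_pqk, torsionlessness becomes G_pqk - G_qpk = eps_pqk
   and compatibility on the central e_k becomes G_pqk + G_kqp = 0, which
   force G_pqk = eps_pqk / 2; conversely these coefficients define a
   connection with both properties. *)
Require Import Defs.
From HB Require Import structures.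
From mathcomp Require Import all_boot all_order all_algebra.
From mathcomp Require Import ring.
Import Order.TTheory GRing.Theory Num.Theory.
Local Open Scope ring_scope.

Set Implicit Arguments.
Unset Strict Implicit.
Unset Printing Implicit Defensive.

Local Notation coord := Defs.coord.
Local Notation i0 := (Ordinal (isT : 0 < 3)%N).
Local Notation i1 := (Ordinal (isT : 1 < 3)%N).
Local Notation i2 := (Ordinal (isT : 2 < 3)%N).

(** * Case analysis and sums over three indices *)

Lemma ord3_ind (P : 'I_3 -> Prop) : P i0 -> P i1 -> P i2 -> forall i, P i.
Proof.
move=> P0 P1 P2 [[|[|[|//]]] h]; [move: P0 | move: P1 | move: P2];
  by congr P; apply: val_inj.
Qed.

Lemma sum3 (V : nmodType) (F : 'I_3 -> V) : \sum_i F i = F i0 + F i1 + F i2.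
Proof.
rewrite !big_ord_recl big_ord0 addr0 addrA.
by congr (F _ + F _ + F _); apply: val_inj.
Qed.

(** * Levi-Civita symbol and Pauli matrices *)

Section LeviCivita.
Variable C : numClosedFieldType.

Lemma eps_antisym (i j k : 'I_3) : eps C j i k = - eps C i j k.
Proof.
by elim/ord3_ind: i; elim/ord3_ind: j; elim/ord3_ind: k;
  rewrite /eps /= ?oppr0 ?opprK.
Qed.

Lemma eps_cyclic (i j k : 'I_3) : eps C j k i = eps C i j k.
Proof.
by elim/ord3_ind: i; elim/ord3_ind: j; elim/ord3_ind: k; rewrite /eps.
Qed.

(** Contraction of two Levi-Civita symbols over one index; it recovers the antisymmetric part of [t]
    from its dual vector. *)
Lemma eps_contract (V : lmodType C) (t : 'I_3 -> 'I_3 -> V) (p q : 'I_3) :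
  \sum_l eps C p q l *: (\sum_k \sum_j eps C k j l *: t k j) = t p q - t q p.
Proof.
elim/ord3_ind: p; elim/ord3_ind: q; rewrite !sum3 /eps /= ?scale0r ?scale1r
  ?scaleN1r ?addr0 ?add0r ?opprD ?opprK ?subrr // addrC //.
Qed.

Lemma eps_contract_sym (V : lmodType C) (t : 'I_3 -> 'I_3 -> V) (l : 'I_3) :
  (forall p q, t p q = t q p) -> \sum_k \sum_j eps C k j l *: t k j = 0.
Proof.
move=> tC; elim/ord3_ind: l; rewrite !sum3 /eps /= ?scale0r ?scale1r ?scaleN1r
  ?addr0 ?add0r ?[t i1 i0]tC ?[t i2 i0]tC ?[t i2 i1]tC ?subrr ?addNr //.
Qed.

(** Quaternion relations: in tau_k tau_j = delta_kj + i sum_l eps_kjl tau_l, the factor i^2 = -1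
    makes both signs negative. *)
Lemma sigmaM (k j : 'I_3) : sigma C k *m sigma C j =
  (- (k == j)%:R)%:M - \sum_l eps C k j l *: sigma C l.
Proof.
have ii : 'i * 'i = -1 :> C by rewrite -expr2 sqrCi.
apply/matrixP=> p q.
elim/ord3_ind: k; elim/ord3_ind: j;
case: p => [[|[|//]] ?]; case: q => [[|[|//]] ?];
rewrite sum3 /eps /= !mxE !big_ord_recl big_ord0 /sigma /tau !mxE /=; ring: ii.
Qed.

Lemma tr_sigma (k : 'I_3) : \tr (sigma C k) = 0.
Proof.
rewrite /mxtrace !big_ord_recl big_ord0 /sigma /tau !mxE.
by elim/ord3_ind: k => /=; ring.
Qed.

Lemma tr_sigmaM (k j : 'I_3) :
  \tr (sigma C k *m sigma C j) = (-2) * (k == j)%:R.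
Proof.
have tr0 : \tr (\sum_l eps C k j l *: sigma C l) = 0.
  by rewrite raddf_sum big1 // => l _; rewrite /= mxtraceZ tr_sigma mulr0.
by rewrite sigmaM raddfB /= tr0 mxtrace_scalar; ring.
Qed.

End LeviCivita.

(** * Inner derivations *)

Section Commutator.
Variables (R : comNzRingType) (n : nat).
Implicit Types a b c x y : 'M[R]_n.

(* Locked: otherwise distributivity lemmas match inside [lie]. *)
Definition lie x a := locked (x *m a - a *m x).

Lemma lieE x a : lie x a = x *m a - a *m x.
Proof. by rewrite /lie -lock. Qed.

Lemma lieD x a b : lie x (a + b) = lie x a + lie x b.
Proof. by rewrite !lieE mulmxDr mulmxDl opprD addrACA. Qed.

Lemma lieZ k x a : lie x (k *: a) = k *: lie x a.
Proof. by rewrite !lieE -scalemxAr -scalemxAl scalerBr. Qed.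

Lemma lie0 x : lie x 0 = 0.
Proof. by rewrite !lieE mulmx0 mul0mx subrr. Qed.

Lemma lie_sum I (r : seq I) x (F : I -> 'M_n) :
  lie x (\sum_(i <- r) F i) = \sum_(i <- r) lie x (F i).
Proof.
by rewrite lieE mulmx_sumr mulmx_suml -sumrB; apply: eq_bigr => i _;
  rewrite lieE.
Qed.

Lemma lie_suml I (r : seq I) a (F : I -> 'M_n) :
  lie (\sum_(i <- r) F i) a = \sum_(i <- r) lie (F i) a.
Proof.
by rewrite lieE mulmx_sumr mulmx_suml -sumrB; apply: eq_bigr => i _;
  rewrite lieE.
Qed.

Lemma lieZl k x a : lie (k *: x) a = k *: lie x a.
Proof. by rewrite !lieE -scalemxAr -scalemxAl scalerBr. Qed.

Lemma lie_comm x a : x *m a = a *m x -> lie x a = 0.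
Proof. by rewrite !lieE => ->; rewrite subrr. Qed.

Lemma lie_scalar x k : lie x k%:M = 0.
Proof. by rewrite lie_comm // scalar_mxC. Qed.

Lemma lieM x a b : lie x (a *m b) = lie x a *m b + a *m lie x b.
Proof. by rewrite !lieE mulmxBl mulmxBr !mulmxA addrA subrK. Qed.

Lemma lie_lie x y b : lie (lie x y) b = lie x (lie y b) - lie y (lie x b).
Proof.
rewrite !lieE !(mulmxBl, mulmxBr) !mulmxA.
move: (x *m y *m b) (y *m x *m b) (b *m x *m y) (b *m y *m x) (x *m b *m y)
  (y *m b *m x) => A1 A2 A3 A4 A5 A6.
by apply/matrixP=> i j; rewrite !mxE; ring.
Qed.

(** Antisymmetrised Leibniz rule: the second derivatives of b form a commutator, which the Jacobi
    identity [lie_lie] cancels. *)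
Lemma lie_wedge x y a b :
  lie x a *m lie y b - lie y a *m lie x b =
  lie x (a *m lie y b) - lie y (a *m lie x b) - a *m lie (lie x y) b.
Proof.
rewrite !lieM lie_lie mulmxBr.
move: (lie x a *m lie y b) (lie y a *m lie x b) (a *m lie x (lie y b))
  (a *m lie y (lie x b)) => A1 A2 A3 A4.
by apply/matrixP=> i j; rewrite !mxE; ring.
Qed.

End Commutator.

(** * Families of matrix units that produce traces *)

Section TraceFamily.
Variables (R : comNzRingType) (n : nat).

(** For a triple [((p, q), r)], E_pq x E_rp = x_qr E_pp: the indices q and r build the trace, and p
    builds the identity matrix. *)
Definition trace_family (Y c : 'M[R]_n) : seq ('M[R]_n * 'M[R]_n) :=
  [seq (Y t.2 t.1.2 *: (c *m delta_mx t.1.1 t.1.2), delta_mx t.2 t.1.1)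
    | t <- enum {: 'I_n * 'I_n * 'I_n}].

Lemma trace_familyE (Y c x y : 'M[R]_n) :
  \sum_(p <- trace_family Y c) p.1 *m x *m p.2 *m y =
  \tr (Y *m x) *: (c *m y).
Proof.
rewrite big_map big_enum /=.
have deltaE (p q r : 'I_n) :
    delta_mx p q *m x *m delta_mx r p = x q r *: delta_mx p p.
  apply/matrixP=> i j; rewrite !mxE (bigD1 r) //= big1 ?addr0 => [|k kr].
    rewrite !mxE eqxx /= (bigD1 q) //= big1 ?addr0 => [|k kq]; last first.
      by rewrite !mxE (negPf kq) andbF mul0r.
    by rewrite !mxE eqxx andbT mulrAC mulrC -natrM mulnb.
  by rewrite [delta_mx r p _ _]mxE (negPf kr) mulr0.
rewrite (eq_bigr (fun t => (Y t.2 t.1.2 * x t.1.2 t.2) *: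
    (c *m delta_mx t.1.1 t.1.1 *m y))) => [|[[p q] r] _ /=]; last first.
  rewrite -!scalemxAl -!mulmxA [_ *m (x *m _)]mulmxA.
  rewrite [_ *m (_ *m y)]mulmxA deltaE.
  by rewrite -scalemxAl -scalemxAr scalerA mulmxA.
rewrite -(pair_big predT predT (fun u r => (Y r u.2 * x u.2 r) *:
    (c *m delta_mx u.1 u.1 *m y))) /=.
rewrite -(pair_big predT predT (fun p q => \sum_r (Y r q * x q r) *:
    (c *m delta_mx p p *m y))) /=.
transitivity (\sum_p \tr (Y *m x) *: (c *m delta_mx p p *m y)).
  apply: eq_bigr => p _; rewrite /mxtrace.
  under [in RHS]eq_bigr do rewrite mxE.
  rewrite exchange_big scaler_suml; apply: eq_bigr => r _ /=.
  by rewrite scaler_suml.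
rewrite -scaler_sumr -mulmx_suml -mulmx_sumr; congr (_ *: (_ *m _)).
by rewrite -[in RHS](mulmx1 c) mx1_sum_delta.
Qed.

End TraceFamily.

(** * Operators on the tensor product, coordinates and products of basis forms *)

Section Tensor.
Variables (C : numClosedFieldType) (N : nat).
Local Notation A := 'M[C]_(dK N).
Implicit Types (a b : A) (s t : 'M[C]_2).

Lemma tensM a b s t : tens a s *m tens b t = tens (a *m b) (s *m t).
Proof.
rewrite /tens mulmx_block !mxE !big_ord_recl !big_ord0 !addr0.
by congr block_mx; rewrite -!scalemxAl -!scalemxAr !scalerA -!scalerDl;
  congr (_ *: _); congr (_ * _ + _ * _); congr (fun_of_matrix _ _ _);
  apply: val_inj.
Qed.

Lemma tensDl a b s : tens (a + b) s = tens a s + tens b s.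
Proof. by rewrite /tens add_block_mx !scalerDr. Qed.

Lemma tensDr a s t : tens a (s + t) = tens a s + tens a t.
Proof. by rewrite /tens add_block_mx !mxE !scalerDl. Qed.

Lemma tensZl c a s : tens (c *: a) s = c *: tens a s.
Proof. by rewrite /tens scale_block_mx !scalerA ![_ * c]mulrC. Qed.

Lemma tensZr c a s : tens a (c *: s) = c *: tens a s.
Proof. by rewrite /tens scale_block_mx !mxE !scalerA. Qed.

Lemma tens0l s : tens (0 : A) s = 0.
Proof. by rewrite -(scale0r (0 : A)) tensZl scale0r. Qed.

Lemma tens0r a : tens a 0 = 0.
Proof. by rewrite -(scale0r (0 : 'M_2)) tensZr scale0r. Qed.

Lemma tensBl a b s : tens (a - b) s = tens a s - tens b s.
Proof. by rewrite -scaleN1r tensDl tensZl scaleN1r. Qed.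

Lemma tensBr a s t : tens a (s - t) = tens a s - tens a t.
Proof. by rewrite -scaleN1r tensDr tensZr scaleN1r. Qed.

Lemma tens_suml I (r : seq I) (F : I -> A) s :
  tens (\sum_(i <- r) F i) s = \sum_(i <- r) tens (F i) s.
Proof.
exact: (big_morph (fun a => tens a s) (fun a b => tensDl a b s) (tens0l s)).
Qed.

Lemma tens_sumr I (r : seq I) a (F : I -> 'M_2) :
  tens a (\sum_(i <- r) F i) = \sum_(i <- r) tens a (F i).
Proof. exact: (big_morph (tens a) (tensDr a) (tens0r a)). Qed.

Lemma tens_scalar a c : tens a c%:M = piA (c *: a).
Proof. by rewrite /piA tensZl -tensZr scalemx1. Qed.

Lemma e_piA a k : e C N k *m piA a = tens a (sigma C k).
Proof. by rewrite tensM mul1mx mulmx1. Qed.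

Lemma piA_e a k : piA a *m e C N k = tens a (sigma C k).
Proof. by rewrite tensM mul1mx mulmx1. Qed.

Lemma ee_piA a k j : e C N k *m e C N j *m piA a =
  tens a (sigma C k *m sigma C j).
Proof. by rewrite !tensM !mul1mx mulmx1. Qed.

Lemma ptr_tens a s : ptr (tens a s) = \tr s *: a.
Proof.
rewrite /ptr /tens block_mxKul block_mxKdr -scalerDl /mxtrace.
rewrite !big_ord_recl big_ord0 addr0.
by congr ((_ + _) *: _); congr (fun_of_matrix _ _ _); apply: val_inj.
Qed.

Lemma coord_linear c (w v : Op C N) k :
  coord (c *: w + v) k = c *: coord w k + coord v k.
Proof.
rewrite /coord mulmxDl -scalemxAl; move: (w *m _) (v *m _) => w' v'.
by apply/matrixP=> i j; rewrite !mxE; ring.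
Qed.

Lemma coordD (w v : Op C N) k : coord (w + v) k = coord w k + coord v k.
Proof. by rewrite -[w]scale1r coord_linear !scale1r. Qed.

Lemma coordB (w v : Op C N) k : coord (w - v) k = coord w k - coord v k.
Proof. by rewrite -scaleN1r addrC coord_linear scaleN1r addrC. Qed.

Lemma coord0 k : coord (0 : Op C N) k = 0.
Proof.
by rewrite /coord mul0mx /ptr /ulsubmx /drsubmx !linear0 addr0 scaler0.
Qed.

Lemma coord_sum I (r : seq I) (F : I -> Op C N) k :
  coord (\sum_(i <- r) F i) k = \sum_(i <- r) coord (F i) k.
Proof.
exact: (big_morph (fun w => coord w k) (fun w v => coordD w v k) (coord0 k)).
Qed.

Lemma coordMr (w : Op C N) a k : coord (w *m piA a) k = coord w k *m a.
Proof.
rewrite /coord -mulmxA piA_e -e_piA mulmxA -scalemxAl; congr (_ *: _).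
move: (w *m _) => v; rewrite /ptr /piA /tens !mxE /= !scale1r !scale0r.
by rewrite -{1 2}[v]submxK mulmx_block !mulmx0 !addr0 !add0r block_mxKul
  block_mxKdr mulmxDl.
Qed.

Lemma coordMl (w : Op C N) a k : coord (piA a *m w) k = a *m coord w k.
Proof.
rewrite /coord -mulmxA -scalemxAr; congr (_ *: _).
move: (w *m _) => v; rewrite /ptr /piA /tens !mxE /= !scale1r !scale0r.
by rewrite -{1 2}[v]submxK mulmx_block !mul0mx !addr0 !add0r block_mxKul
  block_mxKdr mulmxDr.
Qed.

Lemma coord_tens a s k :
  coord (tens a s) k = - 2^-1 *: (\tr (s *m sigma C k) *: a).
Proof. by rewrite /coord tensM mulmx1 ptr_tens. Qed.

(** The sigma_k are trace-orthogonal with square norm -2, which the factor -1/2 in [coord]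
    normalises. *)
Lemma coord_form (x : 'I_3 -> A) k :
  coord (\sum_l tens (x l) (sigma C l)) k = x k.
Proof.
rewrite coord_sum (bigD1 k) //= big1 ?addr0 => [|l lk]; rewrite coord_tens
  tr_sigmaM ?eqxx ?(negPf lk) ?mulr0 ?scale0r ?scaler0 //.
by rewrite mulr1 scalerA mulrNN mulVf ?scale1r ?pnatr_eq0.
Qed.

Lemma coord_piA a k : coord (piA a) k = 0.
Proof. by rewrite coord_tens mul1mx tr_sigma scale0r scaler0. Qed.

(* The product e_k e_j carries the symmetric part of [t] to [piA], which is the
   ambiguity J^2, and the antisymmetric part to the span of the [e_l]. *)
Definition quad (t : T2 C N) : Op C N :=
  \sum_k \sum_j tens (t k j) (sigma C k *m sigma C j).

Lemma quadE (t : T2 C N) : quad t = piA (- \sum_k t k k) -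
  \sum_l tens (\sum_k \sum_j eps C k j l *: t k j) (sigma C l).
Proof.
rewrite /quad.
under eq_bigr do under eq_bigr do rewrite sigmaM tensBr tens_sumr tens_scalar.
under eq_bigr do rewrite sumrB.
rewrite sumrB; congr (_ - _).
  rewrite /piA -sumrN tens_suml; apply: eq_bigr => k _.
  rewrite (bigD1 k) //= big1 ?addr0 => [|j jk].
    by rewrite eqxx scaleN1r.
  by rewrite eq_sym (negPf jk) oppr0 scale0r tens0l.
under eq_bigr do rewrite exchange_big; rewrite exchange_big /=.
apply: eq_bigr => l _; rewrite tens_suml; apply: eq_bigr => k _.
by rewrite tens_suml; apply: eq_bigr => j _; rewrite tensZr tensZl.
Qed.

Lemma quadD (t u : T2 C N) : quad (fun k j => t k j + u k j) = quad t + quad u.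
Proof.
rewrite /quad -[RHS]big_split; apply: eq_bigr => k _; rewrite -[RHS]big_split.
by apply: eq_bigr => j _; rewrite tensDl.
Qed.

Lemma quad_sym (t : T2 C N) : (forall k j, t k j = t j k) ->
  quad t = piA (- \sum_k t k k).
Proof.
move=> tC; rewrite quadE [X in _ - X]big1 ?subr0 // => l _.
by rewrite eps_contract_sym // tens0l.
Qed.

(** Up to sign, the sigma_l coordinates of [quad t] are the dual vector of the antisymmetric part of
    [t], and those of [piA a] vanish. *)
Lemma quad_piA_sym (t : T2 C N) a : quad t = piA a -> forall k j, t k j = t j k.
Proof.
move=> tE k j; apply/eqP; rewrite -subr_eq0 -eps_contract.
rewrite big1 // => l _.
have := congr1 (fun w => coord w l) tE; rewrite /= quadE coordB coord_form.
rewrite !coord_piA add0r => /eqP.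
by rewrite oppr_eq0 => /eqP ->; rewrite scaler0.
Qed.

Lemma wedge_repE (t : T2 C N) : wedge_rep t = quad t.
Proof.
by apply: eq_bigr => k _; apply: eq_bigr => j _; rewrite ee_piA.
Qed.

End Tensor.

(** * Block-diagonal products, and the trace form on an image of su(2) *)

Lemma mul_mxdiag (R : pzSemiRingType) p (p_ : 'I_p -> nat)
    (B D : forall i, 'M[R]_(p_ i)) :
  mxdiag B *m mxdiag D = mxdiag (fun i => B i *m D i).
Proof.
rewrite {2}/mxdiag mul_mxdiag_mxblock; apply: eq_mxblock => i j.
case: eqP => [<-|_]; last by rewrite mulmx0.
by rewrite !conform_mx_id.
Qed.

Section TraceForm.
Variables (C : numClosedFieldType) (n : nat).
Implicit Types x y z : 'M[C]_n.

Lemma tr_lie x y : \tr (lie x y) = 0.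
Proof. by rewrite lieE raddfB /= mxtrace_mulC subrr. Qed.

Lemma tr_lieM x y z : \tr (lie x y *m z) = \tr (x *m lie y z).
Proof.
rewrite !lieE mulmxBl mulmxBr !raddfB /= !mulmxA; congr (_ - _).
by rewrite -[y *m x *m z]mulmxA mxtrace_mulC.
Qed.

Lemma tr_lieMr x y : \tr (lie x y *m x) = 0.
Proof. by rewrite mxtrace_mulC -tr_lieM lieE subrr mul0mx raddf0. Qed.

(** For skew-adjoint x, -tr(x x) is the sum of the |x_ij|^2, so every entry vanishes. *)
Lemma tr_sqr_eq0 x : adjmx x = - x -> \tr (x *m x) = 0 -> x = 0.
Proof.
move=> xadj tr0; have conjx i j : x j i = - (x i j)^*.
  have := congr1 (fun M : 'M_n => - M j i) xadj.
  by rewrite !mxE opprK => ->.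
have sum0 : \sum_i \sum_j `|x i j| ^+ 2 = 0.
  transitivity (- \tr (x *m x)); last by rewrite tr0 oppr0.
  rewrite /mxtrace -[RHS]sumrN; apply: eq_bigr => i _.
  rewrite mxE -[RHS]sumrN; apply: eq_bigr => j _.
  by rewrite [x j i]conjx mulrN opprK normCK.
apply/matrixP=> i j; rewrite mxE.
have sq_ge0 k l : 0 <= `|x k l| ^+ 2 by rewrite exprn_ge0.
have row0 := psumr_eq0P (fun k _ => sumr_ge0 _ (fun l _ => sq_ge0 k l)) sum0.
have := psumr_eq0P (fun l _ => sq_ge0 i l) (row0 i isT).
by move=> /(_ j isT) /eqP; rewrite sqrf_eq0 normr_eq0 => /eqP.
Qed.

Variable B : 'I_3 -> 'M[C]_n.
Hypothesis lieB : forall k l, lie (B k) (B l) = \sum_q eps C k l q *: B q.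

(** Being a commutator, each generator has trace zero and is zero in dimension one. *)
Lemma su2_gen : [/\ B i0 = lie (B i1) (B i2), B i1 = lie (B i2) (B i0)
  & B i2 = lie (B i0) (B i1)].
Proof.
by split; rewrite lieB sum3 /eps /= !scale0r scale1r ?addr0 ?add0r.
Qed.

Lemma tr_su2 k : \tr (B k) = 0.
Proof.
have [B0 B1 B2] := su2_gen.
by elim/ord3_ind: k; rewrite (B0, B1, B2) tr_lie.
Qed.

(** Distinct generators are orthogonal because one is a commutator with the other; invariance
    [tr_lieM] carries the square norm from one generator to the next. *)
Lemma tr_su2M k l : \tr (B k *m B l) = (k == l)%:R * \tr (B i0 *m B i0).
Proof.
have [B0 B1 B2] := su2_gen.
have tr01 : \tr (B i0 *m B i1) = 0 by rewrite B0 tr_lieMr.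
have tr12 : \tr (B i1 *m B i2) = 0 by rewrite B1 tr_lieMr.
have tr20 : \tr (B i2 *m B i0) = 0 by rewrite B2 tr_lieMr.
have tr11 : \tr (B i1 *m B i1) = \tr (B i0 *m B i0).
  by rewrite {1}B0 tr_lieM -B1.
have tr22 : \tr (B i2 *m B i2) = \tr (B i0 *m B i0).
  by rewrite -tr11 {1}B1 tr_lieM -B2.
elim/ord3_ind: k; elim/ord3_ind: l; rewrite /= ?mul0r ?mul1r //;
  by rewrite mxtrace_mulC.
Qed.

End TraceForm.

(** * One-forms, their differentials and the ambiguity J^2 *)

Section Calculus.
Variables (C : numClosedFieldType) (N : nat).
Variable rho : forall n : 'I_N.+1, 'I_3 -> 'M[C]_(blk n).
Hypothesis hrho : forall n, su2_unitary_irrep (rho n).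
Local Notation A := 'M[C]_(dK N).
Local Notation X := (Defs.X rho).
Implicit Types (a b c x y : A) (s : seq (Alg C N * Alg C N)).

Lemma dA_E a : dA rho a = \sum_k tens (lie (X k) a) (sigma C k).
Proof.
rewrite /dA /comm /DN mulmx_suml mulmx_sumr -sumrB; apply: eq_bigr => k _.
by rewrite !tensM mulmx1 mul1mx -tensBl lieE.
Qed.

Lemma coord_dA a k : coord (dA rho a) k = lie (X k) a.
Proof. by rewrite dA_E coord_form. Qed.

Definition coeff s k : A := \sum_(p <- s) p.1 *m lie (X k) p.2.

Lemma oneformE s :
  oneform rho s = \sum_k tens (coeff s k) (sigma C k).
Proof.
rewrite /oneform; under [RHS]eq_bigr do rewrite tens_suml.
rewrite exchange_big; apply: eq_bigr => p _; rewrite dA_E mulmx_sumr.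
by apply: eq_bigr => k _; rewrite tensM mul1mx.
Qed.

Lemma coord_oneform s k : coord (oneform rho s) k = coeff s k.
Proof. by rewrite oneformE coord_form. Qed.

Definition dcoeff s k j : A := \sum_(p <- s) lie (X k) p.1 *m lie (X j) p.2.

Lemma dformE s : dform rho s = quad (dcoeff s).
Proof.
rewrite /dform /quad.
under [RHS]eq_bigr do under eq_bigr do rewrite tens_suml.
under [RHS]eq_bigr do rewrite exchange_big.
rewrite [RHS]exchange_big; apply: eq_bigr => p _.
rewrite !dA_E mulmx_suml; apply: eq_bigr => k _; rewrite mulmx_sumr.
by apply: eq_bigr => j _; rewrite tensM.
Qed.

Lemma lie_X k l : lie (X k) (X l) = \sum_q eps C k l q *: X q.
Proof.
rewrite !lieE /Defs.X !mul_mxdiag -mxdiagB.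
under [RHS]eq_bigr => q _.
  have -> : eps C k l q *: mxdiag (fun n => rho n q) =
      mxdiag (fun n => eps C k l q *: rho n q).
    by rewrite -mul_scalar_mx -mxdiagZ mul_mxdiag; apply: eq_mxdiag => n;
      rewrite mul_scalar_mx.
  over.
by rewrite -mxdiag_sum; apply: eq_mxdiag => n; have [_ -> _] := hrho n.
Qed.

(** The right side depends on [s] only through the coefficients of its one-form, so d is well
    defined up to symmetric coefficients. *)
Lemma dcoeff_antisym s k j : dcoeff s k j - dcoeff s j k =
  lie (X k) (coeff s j) - lie (X j) (coeff s k)
  - \sum_q eps C k j q *: coeff s q.
Proof.
rewrite /dcoeff /coeff -sumrB !lie_sum.
under [X in _ = _ - _ - X]eq_bigr do rewrite scaler_sumr.
rewrite exchange_big -!sumrB; apply: eq_bigr => p _ /=.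
rewrite lie_wedge lie_X lie_suml mulmx_sumr; congr (_ - _).
by apply: eq_bigr => q _; rewrite lieZl -scalemxAr.
Qed.

Lemma adj_X k : adjmx (X k) = - X k.
Proof.
(* Stated for separate block indices so that, on the diagonal, their equality can be substituted in
   the types. *)
have adjE n m p q :
    ((if n == m then conform_mx 0 (rho n k)^T else 0 : 'M_(blk n, blk m)) p q)^*
    = - (if n == m then conform_mx 0 (rho n k) else 0 : 'M_(blk n, blk m)) p q.
  case: eqP => [mn|_]; last by rewrite !mxE conjC0 oppr0.
  subst m; rewrite !conform_mx_id.
  have [h _ _] := hrho n; have := congr1 (fun M : 'M_ _ => M p q) (h k).
  by rewrite !mxE.
apply/matrixP=> i j; rewrite /adjmx /Defs.X tr_mxdiag /mxdiag /mxblock.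
by rewrite mxE [in LHS]mxE [in RHS]mxE [in RHS]mxE adjE.
Qed.

Local Notation kappa := (\tr (X i0 *m X i0)).

Lemma kappa_neq0 : (1 <= N)%N -> kappa != 0.
Proof.
move=> N_gt0; apply/eqP => tr0.
(* All X_k share the square norm kappa, so they vanish together. *)
have X0 k : X k = 0.
  by apply: tr_sqr_eq0; rewrite ?adj_X // (tr_su2M lie_X) tr0 mulr0.
have rho0 n k : rho n k = 0.
  have := X0 k; rewrite /Defs.X -mxdiag0.
  by move/(eq_mxdiagP (fun n => rho n k) (fun n => 0))/(_ n).
have [_ _ irr] := hrho ord_max.
(* With zero generators every subspace is invariant; this line is nonzero, and it is proper because
   the top block has dimension N+1 >= 2. *)
have /orP[] : (delta_mx ord0 ord0 == 0 :> 'M[C]_(blk (@ord_max N)))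
    || row_full (delta_mx ord0 ord0 : 'M[C]_(blk (@ord_max N))).
- by apply: irr => k; rewrite rho0 trmx0 mulmx0 sub0mx.
- move/eqP/matrixP/(_ ord0 ord0)/eqP.
  by rewrite !mxE !eqxx oner_eq0.
by rewrite /row_full mxrank_delta /blk /= eqSS eq_sym -leqn0 leqNgt N_gt0.
Qed.

(** The projection P on the summand n = 0, which has dimension one. *)
Definition bottom : A := mxdiag (fun n => (n == ord0)%:R%:M).

Lemma bottom_X k : bottom *m X k = 0.
Proof.
rewrite /bottom /Defs.X mul_mxdiag -mxdiag0; apply: eq_mxdiag => n.
case: eqP => [->|_]; last by rewrite -scalemx1 scale0r mul0mx.
have [_ h _] := hrho ord0; rewrite mul1mx.
have comm1 (x y : 'M[C]_(blk (@ord0 N))) : lie x y = 0.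
  by rewrite !lieE [x]mx11_scalar scalar_mxC subrr.
have lie_rho k' l : lie (rho ord0 k') (rho ord0 l) =
  \sum_q eps C k' l q *: rho ord0 q by rewrite lieE.
by have [B0 B1 B2] := su2_gen lie_rho; elim/ord3_ind: k; rewrite (B0, B1, B2).
Qed.

Lemma tr_bottom : \tr bottom = 1.
Proof.
rewrite mxtrace_mxdiag (bigD1 ord0) //= big1 ?addr0 => [|n n0].
  by rewrite mxtrace_scalar.
by rewrite mxtrace_scalar (negPf n0) mul0rn.
Qed.

(** The two terms of the commutator are [trace_familyE] at [(X k, 1)] and at [(1, X k)]. *)
Lemma coeff_trace_family (Y c : A) k :
  coeff (trace_family Y c) k = \tr (Y *m X k) *: c - \tr Y *: (c *m X k).
Proof.
rewrite /coeff -[c in X in X - _]mulmx1 -[Y in X in _ - X]mulmx1.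
rewrite -!trace_familyE -sumrB; apply: eq_bigr => p _.
by rewrite !lieE mulmxBr !mulmxA !mulmx1.
Qed.

Lemma Omega1_e k : (1 <= N)%N -> Omega1 rho (e C N k).
Proof.
(* This Y is traceless, which removes the term in X_l; orthogonality leaves only the coefficient l =
   k, normalised to 1. *)
move=> /kappa_neq0 k0; exists (trace_family (kappa^-1 *: X k) 1%:M).
rewrite oneformE (bigD1 k) //= big1 ?addr0 => [|l lk]; rewrite
  coeff_trace_family -scalemxAl !mxtraceZ (tr_su2 lie_X) (tr_su2M lie_X k)
  mulr0 scale0r subr0.
  by rewrite eqxx mul1r mulVf // scale1r.
by rewrite eq_sym (negPf lk) mul0r mulr0 scale0r tens0l.
Qed.

(** When the one-form vanishes, only the second-order sum remains, which [trace_familyE] can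
    evaluate. *)
Lemma dcoeffE s k j : dcoeff s k j =
  lie (X k) (coeff s j) - \sum_(p <- s) p.1 *m lie (X k) (lie (X j) p.2).
Proof.
rewrite /dcoeff /coeff lie_sum -sumrB; apply: eq_bigr => p _.
by rewrite lieM addrK.
Qed.

(** Vanishing coefficients make [dcoeff] symmetric by [dcoeff_antisym], so only the scalar part of
    the product survives. *)
Lemma J2_sym (x : Op C N) : J2 rho x -> exists a, x = piA a.
Proof.
move=> [s [s0 ->]]; rewrite dformE quad_sym => [|k j]; first by eexists.
have c0 q : coeff s q = 0 by rewrite -coord_oneform s0 coord0.
apply/eqP; rewrite -subr_eq0 dcoeff_antisym !c0 !lie0 big1 ?subrr // => q _.
by rewrite c0 scaler0.
Qed.

Lemma J2_piA a : (1 <= N)%N -> J2 rho (piA a).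
Proof.
move=> /kappa_neq0 k0.
(* As tr 1 = dim K_N and tr P = 1, Y is traceless, while P X_k = 0 keeps Y X_k = X_k. The resulting
   one-form is zero, but its second-order sum is not. *)
pose Y : A := 1%:M - (dK N)%:R *: bottom.
have trY : \tr Y = 0.
  by rewrite raddfB /= mxtraceZ tr_bottom mulr1 mxtrace1 subrr.
have YX k : Y *m X k = X k.
  by rewrite mulmxBl mul1mx -scalemxAl bottom_X scaler0 subr0.
(* [quad_sym] negates the sum of three diagonal terms, each equal to -kappa c; this c makes the
   result a. *)
pose c := (3%:R * kappa)^-1 *: a; pose s := trace_family Y c.
have c0 k : coeff s k = 0.
  by rewrite coeff_trace_family YX trY (tr_su2 lie_X) !scale0r subr0.
exists s; split.
  by rewrite oneformE big1 // => k _; rewrite c0 tens0l.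
have dd k : dcoeff s k k = - (kappa *: c).
  rewrite dcoeffE c0 lie0 sub0r; congr (- _).
  (* The terms match [X_k,[X_k,b]] = X_k X_k b - 2 X_k b X_k + b X_k X_k; only the first has a
     nonzero trace factor, namely kappa. *)
  have -> : kappa *: c = \tr (Y *m (X k *m X k)) *: (c *m 1%:M)
      - \tr (Y *m X k) *: (c *m X k) - (\tr (Y *m X k) *: (c *m X k)
      - \tr (Y *m 1%:M) *: (c *m (X k *m X k))).
    rewrite mulmxA !YX !mulmx1 trY (tr_su2 lie_X) !scale0r !subr0.
    by rewrite (tr_su2M lie_X k) eqxx mul1r.
  rewrite -!trace_familyE -!sumrB; apply: eq_bigr => p _.
  by rewrite !lieE !mulmxBr !mulmxBl !mulmxBr !mulmxA !mulmx1.
rewrite dformE quad_sym => [|k j]; last first.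
  apply/eqP; rewrite -subr_eq0 dcoeff_antisym !c0 !lie0 big1 ?subrr // => q _.
  by rewrite c0 scaler0.
congr piA; rewrite sum3 !dd /c scalerA invfM.
rewrite mulrCA mulfV // mulr1; apply/matrixP => i j; rewrite !mxE.
by field.
Qed.

End Calculus.

(** * Existence of the Levi-Civita connection *)

Section Connection.
Variables (C : numClosedFieldType) (N : nat).
Variable rho : forall n : 'I_N.+1, 'I_3 -> 'M[C]_(blk n).
Hypothesis hrho : forall n, su2_unitary_irrep (rho n).
Local Notation A := 'M[C]_(dK N).
Local Notation X := (Defs.X rho).

Lemma coord_e (k q : 'I_3) : coord (e C N k) q = (k == q)%:R%:M.
Proof.
rewrite coord_tens tr_sigmaM scalerA mulrA mulrNN mulVf
  ?pnatr_eq0 // mul1r.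
by rewrite scalemx1.
Qed.

(** Leibniz extension of nabla(e_m) = 1/2 sum_pq eps_pqm e_p (x) e_q to w = sum_m e_m w_m; the
    second term comes from e_p (x) d(w_p). *)
Definition levi_civita (w : Op C N) : T2 C N := fun p q =>
  \sum_m (2^-1 * eps C p q m) *: coord w m + lie (X q) (coord w p).

Lemma levi_civita_connection : is_connection rho levi_civita.
Proof.
split=> [c w v _ _ k j|w a _ k j]; rewrite /levi_civita.
  rewrite coord_linear lieD lieZ scalerDr addrACA; congr (_ + _).
    rewrite scaler_sumr -[RHS]big_split; apply: eq_bigr => m _.
  by rewrite coord_linear scalerDr !scalerA [c * _]mulrC.
rewrite coordMr lieM coord_dA mulmxDl addrA; congr (_ + _ + _).
by rewrite mulmx_suml; apply: eq_bigr => m _; rewrite coordMr scalemxAl.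
Qed.

Lemma levi_civita_torsionless : (1 <= N)%N -> torsionless rho levi_civita.
Proof.
move=> N_gt0 s; rewrite wedge_repE dformE -quadD quad_sym.
  exact: J2_piA.
(* Antisymmetrising doubles the terms in 1/2 eps; together with the derivative terms they cancel
   those of [dcoeff_antisym]. *)
move=> k j; apply/eqP; rewrite -subr_eq0 opprD addrACA dcoeff_antisym //.
rewrite /levi_civita !coord_oneform.
have -> : \sum_m (2^-1 * eps C k j m) *: coord (oneform rho s) m =
    2^-1 *: \sum_q eps C k j q *: coeff rho s q.
  by rewrite scaler_sumr; apply: eq_bigr => m _;
    rewrite coord_oneform scalerA.
have -> : \sum_m (2^-1 * eps C j k m) *: coord (oneform rho s) m =
    - (2^-1 *: \sum_q eps C k j q *: coeff rho s q).
  rewrite scaler_sumr -sumrN; apply: eq_bigr => m _.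
  by rewrite coord_oneform scalerA eps_antisym mulrN scaleNr.
move: (\sum_q _) (lie _ _) (lie _ _) => S L1 L2.
by apply/eqP/matrixP => p q; rewrite !mxE; field.
Qed.

Lemma central_coord w k : central rho w -> forall a : A,
  a *m coord w k = coord w k *m a.
Proof. by move=> [_ wC] a; rewrite -coordMl wC coordMr. Qed.

Lemma levi_civita_compatible : compatible rho levi_civita.
Proof.
move=> w v wZ vZ.
have wC := fun k => central_coord k wZ; have vC := fun k => central_coord k vZ.
(* Central forms have central coefficients, so every derivative term drops out on both sides. *)
have lie_w x k : lie x (coord w k) = 0 by rewrite lie_comm.
have lie_v x k : lie x (coord v k) = 0 by rewrite lie_comm.
rewrite dA_E [RHS]big1 => [|k _]; last first.
  rewrite lie_sum big1 ?tens0l // => m _.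
  by rewrite lieM lie_w lie_v mul0mx mulmx0 addr0.
rewrite big1 // => l _; rewrite e_piA.
set S := (S in tens S _); suff -> : S = 0 by rewrite tens0l.
rewrite {}/S big_split /=.
have -> : \sum_k levi_civita w k l *m coord v k =
    \sum_k \sum_m (2^-1 * eps C k l m) *: (coord w m *m coord v k).
  apply: eq_bigr => k _; rewrite /levi_civita lie_w addr0 mulmx_suml.
  by apply: eq_bigr => m _; rewrite scalemxAl.
(* Relabelling the first sum pairs the terms in w_k v_m, whose factors eps_mlk and eps_klm are
   opposite. *)
rewrite exchange_big -big_split big1 // => k _ /=.
rewrite /levi_civita lie_v addr0 mulmx_sumr -big_split big1 // => m _ /=.
move: (coord w k) (coord v m) => a b.
rewrite -scalemxAr -scalerDl -mulrDr.
by rewrite -[eps C m l k]eps_cyclic eps_antisym -eps_cyclic addNr mulr0 scale0r.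
Qed.

(** * Uniqueness: the Christoffel coefficients of any solution *)

Variable nabla : Op C N -> T2 C N.
Hypotheses (N_gt0 : (1 <= N)%N) (torsion0 : torsionless rho nabla)
  (metric : compatible rho nabla).

Let G (p q k : 'I_3) : A := nabla (e C N k) p q.

Lemma e_central k : central rho (e C N k).
Proof.
by split=> [|a]; [exact: Omega1_e | rewrite piA_e e_piA].
Qed.

(** As e_k has constant coefficients, d(e_k) antisymmetrises to -eps_pqk; its sum with nabla(e_k)
    lies in J^2 after wedging, so the total coefficients are symmetric. *)
Lemma christoffel_torsion p q k : G p q k - G q p k = (eps C p q k)%:M.
Proof.
have [s es] := Omega1_e hrho k N_gt0.
have cE l : coeff rho s l = (k == l)%:R%:M.
  by rewrite -coord_oneform -es coord_e.
have dE : dcoeff rho s p q = dcoeff rho s q p - (eps C p q k)%:M.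
  apply/eqP; rewrite addrC -subr_eq dcoeff_antisym // !cE !lie_scalar subrr.
  rewrite sub0r eqr_opp (bigD1 k) //= big1 ?addr0 => [|l lk].
    by rewrite cE eqxx scalemx1.
  by rewrite cE eq_sym (negPf lk) -scalemx1 scale0r scaler0.
have := torsion0 s; rewrite wedge_repE dformE -quadD -es.
move=> /(J2_sym hrho)[a] /quad_piA_sym /(_ p q); rewrite dE -/(G p q k).
move: (dcoeff _ _ _ _) (_%:M) => D E GE; apply/eqP; rewrite subr_eq; apply/eqP.
by apply: (addIr (D - E)); rewrite GE [E + _]addrC -addrA [E + _]addrC subrK.
Qed.

(** Compatibility at e_k and e_p, read at e_q; its right side is the differential of a scalar, hence
    zero. *)
Lemma christoffel_metric p q k : G p q k + G k q p = 0.
Proof.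
have deltaE (F : 'I_3 -> A) l : \sum_m F m *m (l == m)%:R%:M = F l.
  rewrite (bigD1 l) //= eqxx mulmx1 big1 ?addr0 // => m ml.
  by rewrite eq_sym (negPf ml) -scalemx1 scale0r mulmx0.
have contrE l : \sum_m (nabla (e C N k) m l *m coord (e C N p) m
    + coord (e C N k) m *m nabla (e C N p) m l) = G p l k + G k l p.
  rewrite big_split /= -[in RHS](deltaE (fun m => G m l k) p).
  rewrite -[in RHS](deltaE (fun m => G m l p) k); congr (_ + _).
    by apply: eq_bigr => m _; rewrite coord_e.
  by apply: eq_bigr => m _; rewrite coord_e -scalar_mxC.
have := metric (e_central k) (e_central p).
under eq_bigr do rewrite contrE e_piA.
have -> : \sum_m coord (e C N k) m *m coord (e C N p) m = (k == p)%:R%:M.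
  rewrite -coord_e -[RHS](deltaE (fun m => coord (e C N k) m) p).
  by apply: eq_bigr => m _; rewrite (coord_e p).
move=> /(congr1 (fun w => coord w q)).
by rewrite coord_form coord_dA lie_scalar.
Qed.

Lemma christoffelE p q k : G p q k = (2^-1 * eps C p q k)%:M.
Proof.
have antisym a b c : G a b c = - G c b a.
  by apply/eqP; rewrite -addr_eq0 christoffel_metric.
have torsion a b c : G a b c = (eps C a b c)%:M + G b a c.
  by rewrite -christoffel_torsion subrK.
(* As in Koszul's argument, torsion, metric and torsion relations are chained; the two eps terms
   agree by cyclicity and cancel. *)
have step a b c : G a b c = - G a c b.
  rewrite torsion [G b a c]antisym torsion (eps_cyclic C b c a).
  by rewrite (eps_cyclic C a b c) opprD addrA subrr sub0r.
(* Two sign changes permute the indices cyclically; the torsion and metric relations then lead back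
   to -G p q k. *)
have GE : G p q k = (eps C p q k)%:M - G p q k.
  by rewrite {1}step antisym opprK torsion (eps_cyclic C p q k) [G k q p]antisym.
have /(congr1 (fun x => 2^-1 *: x)) : 2%:R *: G p q k = (eps C p q k)%:M.
  by rewrite scaler_nat mulr2n {1}GE subrK.
by rewrite scalerA mulVf ?pnatr_eq0 // scale1r scale_scalar_mx.
Qed.

(** The minus sign comes from the transposition turning eps_jlk into eps_jkl. *)
Lemma omegaE j k :
  omega nabla j k = - 2%:R^-1 *: \sum_(l < 3) eps C j k l *: e C N l.
Proof.
rewrite /omega scaler_sumr; apply: eq_bigr => l _.
rewrite -/(G j l k) christoffelE e_piA -scalemx1 tensZl scalerA.
by rewrite -(eps_cyclic C j l k) eps_antisym (eps_cyclic C j k l) mulrN mulNr.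
Qed.

End Connection.

(** The second half contains uniqueness: the omega_jk fix nabla on the basis, and linearity with the
    Leibniz rule extends this to all one-forms. *)
Theorem theorem8p6 (C : numClosedFieldType) (N : nat) (hN : (1 <= N)%N)
  (rho : forall n : 'I_N.+1, 'I_3 -> 'M[C]_(blk n))
  (hrho : forall n : 'I_N.+1, su2_unitary_irrep (rho n)) :
  (exists nabla : Op C N -> T2 C N,
     [/\ is_connection rho nabla, torsionless rho nabla & compatible rho nabla]) /\
  (forall nabla : Op C N -> T2 C N,
     is_connection rho nabla -> torsionless rho nabla -> compatible rho nabla ->
     forall j k : 'I_3,
       omega nabla j k = - 2%:R^-1 *: \sum_(l < 3) eps C j k l *: e C N l).
Proof.
split.
  exists (levi_civita rho); split; [exact: levi_civita_connection
    | exact: levi_civita_torsionless | exact: levi_civita_compatible].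
by move=> nabla _ tors compat j k; exact: (omegaE hrho hN tors compat).
Qed.
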